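(* Let $M$ be a qc manifold of dimension $4n+3$ and let $f$ be a smooth function on $M$. Then $$-\frac12\triangle|\nabla f|^2=|\nabla^2f|^2-g\big(\nabla(\triangle f),\nabla f\big)+Ric(\nabla f,\nabla f)+2\sum_{s=1}^3T(\xi_s,I_s\nabla f,\nabla f)+4\sum_{s=1}^3\nabla^2f(\xi_s,I_s\nabla f).$$
   Context: Quaternionic contact (qc) manifold $(M,g,\mathbb{Q})$ of dimension $4n+3$: a manifold $M$ with a codimension three distribution $H$ (the horizontal space), locally the kernel of an $\mathbb{R}^3$-valued 1-form $\eta=(\eta_1,\eta_2,\eta_3)$; a Riemannian metric $g$ on $H$; and a rank three bundle $\mathbb{Q}$ of endomorphisms of $H$ locally generated by three almost complex structures $I_1,I_2,I_3$ on $H$ with $I_1I_2=-I_2I_1=I_3$, $I_1I_2I_3=-\mathrm{id}_H$, $g(I_s\cdot,I_s\cdot)=g(\cdot,\cdot)$ and $2g(I_sX,Y)=d\eta_s(X,Y)$ for $X,Y\in H$, $s=1,2,3$ (with $d\eta(A,B)=A\eta(B)-B\eta(A)-\eta([A,B])$). Reeb vector fields $\xi_1,\xi_2,\xi_3$ are determined by $\eta_s(\xi_k)=\delta_{sk}$, $(\xi_s\lrcorner d\eta_s)_{|H}=0$, $(\xi_s\lrcorner d\eta_k)_{|H}=-(\xi_k\lrcorner d\eta_s)_{|H}$; they exist locally if $n>1$, and in dimension seven ($n=1$) their existence is part of the definition of a qc structure. Put $V=\mathrm{span}\{\xi_1,\xi_2,\xi_3\}$; $g$ is extended to $TM=H\oplus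 V$ by $V\perp H$, $g(\xi_s,\xi_k)=\delta_{sk}$. The Biquard connection is the unique connection $\nabla$ on $M$, with torsion $T(A,B)=\nabla_AB-\nabla_BA-[A,B]$, such that: (i) $\nabla$ preserves $H\oplus V$ and the $Sp(n)Sp(1)$-structure on $H$ ($\nabla g=0$, $\nabla\sigma\in\Gamma(\mathbb{Q})$ for $\sigma\in\Gamma(\mathbb{Q})$) and $T(X,Y)=-[X,Y]_{|V}$ for $X,Y\in H$; (ii) for $\xi\in V$ the endomorphism $T_\xi=T(\xi,\cdot)_{|H}$ of $H$ lies in $(sp(n)\oplus sp(1))^{\perp}\subset gl(4n)$, with respect to the inner product $\langle A,B\rangle=\sum_a g(Ae_a,Be_a)$; (iii) $\nabla$ on $V$ is induced by the identification $\varphi:\xi_s\mapsto I_s$ of $V$ with $sp(1)=\mathbb{Q}$, i.e. $\nabla\varphi=0$. We write $T(A,B,C)=g(T(A,B),C)$. $\{e_1,\dots,e_{4n}\}$ is a local orthonormal basis of $H$ and repeated $e_a$ are summed. Curvature: $R(A,B)=[\nabla_A,\nabla_B]-\nabla_{[A,B]}$, $R(A,B,C,D)=g(R(A,B)C,D)$; qc-Ricci tensor: $Ric(A,B)=R(e_b,A,B,e_b)$. For a smooth function $h$: $\nabla h\in H$ is the horizontal gradient, $g(\nabla h,X)=dh(X)$ for $X\in H$; $\nabla^2h(A,B)=A(Bh)-(\nabla_AB)h$; $|\nabla^2h|^2=\nabla^2h(e_a,e_b)\nabla^2h(e_a,e_b)$ (horizontal Hessian); the sub-Laplacian is $\triangle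 h=-\nabla^2h(e_a,e_a)$; $|\nabla h|^2=dh(e_a)dh(e_a)$. *)

(* Defs.v *)
From HB Require Import structures.
From mathcomp Require Import all_boot all_order all_algebra.
From mathcomp Require Import all_classical all_reals all_analysis.

Set Implicit Arguments.
Unset Strict Implicit.
Unset Printing Implicit Defensive.

Import Order.TTheory GRing.Theory Num.Theory.
Import numFieldNormedType.Exports.

Local Open Scope classical_set_scope.
Local Open Scope ring_scope.

(* Meaningful for U open; the derivatives are those of the total function f,
   which at a point of an open U only see f restricted to U. *)
Fixpoint Ck (R : realType) (E F : normedModType R) (k : nat) (U : set E)
    (f : E -> F) {struct k} : Prop :=
  match k with
  | 0 => forall x, U x -> {for x, continuous f}
  | j.+1 => (forall x, U x -> differentiable f x) /\
            (forall v : E, Ck j U (fun x => 'D_v f x))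
  end.

Definition Cinfty (R : realType) (E F : normedModType R) (U : set E)
    (f : E -> F) : Prop := forall k, Ck k U f.

Record chart (R : realType) (m : nat) (M : topologicalType) := Chart {
  chart_dom : set M;
  chart_map : M -> 'rV[R]_m;
  chart_inv : 'rV[R]_m -> M;
  chart_dom_open : open chart_dom;
  chart_img_open : open (chart_map @` chart_dom);
  chart_mapK : forall p, chart_dom p -> chart_inv (chart_map p) = p;
  chart_map_continuous :
    forall p, chart_dom p -> {for p, continuous chart_map};
  chart_inv_continuous :
    forall x, (chart_map @` chart_dom) x -> {for x, continuous chart_inv} }.

Record manifold (R : realType) (m : nat) := Manifold {
  manifold_carrier :> topologicalType;
  manifold_hausdorff : hausdorff_space manifold_carrier;
  manifold_second_countable : @second_countable manifold_carrier;
  atlas : set (chart R m manifold_carrier);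
  atlas_cover : forall p, exists2 c, atlas c & chart_dom c p;
  atlas_smooth : forall c d, atlas c -> atlas d ->
    Cinfty (chart_map c @` (chart_dom c `&` chart_dom d))
           (fun x => chart_map d (chart_inv c x)) }.

Section Calculus.
Context {R : realType} {m : nat} {M : manifold R m}.
Implicit Types (U W : set M) (p : M) (f h : M -> R).

Definition smooth_on U f : Prop := forall c, @atlas R m M c ->
  Cinfty (chart_map c @` (chart_dom c `&` U)) (fun x => f (chart_inv c x)).

Definition smooth_germ p f : Prop :=
  exists U, [/\ open U, U p & smooth_on U f].

(* Tangent vectors at p are derivations of the germs of smooth functions at p.
   The last clause of [tangent] makes the value on functions that are not
   smooth near p irrelevant, so that Leibniz equality of [tvec]s is equality
   of tangent vectors; the module structure is the pointwise one. *)
Definition tvec : Type := (M -> R) -> R^o.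

Definition tangent p (v : tvec) : Prop :=
  [/\ forall (a : R) f h, smooth_germ p f -> smooth_germ p h ->
        v (fun q => a * f q + h q) = a * v f + v h,
      forall f h, smooth_germ p f -> smooth_germ p h ->
        v (fun q => f q * h q) = v f * h p + f p * v h,
      forall f h, smooth_germ p f -> smooth_germ p h ->
        (\forall q \near p, f q = h q) -> v f = v h
    & forall f, ~ smooth_germ p f -> v f = 0].

Definition field : Type := M -> tvec.
Implicit Types (X Y Z : field).

(* The function X f is [fun q => X q f]. *)
Definition vfield U X : Prop :=
  (forall p, U p -> tangent p (X p)) /\
  (forall W f, open W -> W `<=` U -> smooth_on W f ->
     smooth_on W (fun q => X q f)).

Definition bracket X Y : field := fun p f =>
  if `[< smooth_germ p f >]
  then X p (fun q => Y q f) - Y p (fun q => X q f) else 0.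

Definition oneform U (eta : M -> tvec -> R) : Prop :=
  (forall p, U p -> forall (a : R) u v, tangent p u -> tangent p v ->
     eta p (a *: u + v) = a * eta p u + eta p v) /\
  (forall W X, open W -> W `<=` U -> vfield W X ->
     smooth_on W (fun q => eta q (X q))).

Definition dform (eta : M -> tvec -> R) X Y p : R :=
  X p (fun q => eta q (Y q)) - Y p (fun q => eta q (X q))
  - eta p (bracket X Y p).

(* [nabla p v Y] is the covariant derivative at p, in the direction v, of a
   vector field Y which only needs to be smooth near p. *)
Definition connection (nabla : M -> tvec -> field -> tvec) : Prop :=
  [/\ forall U p v Y, open U -> U p -> tangent p v -> vfield U Y ->
        tangent p (nabla p v Y),
      forall U p (a : R) u v Y, open U -> U p -> tangent p u -> tangent p v ->
        vfield U Y ->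
        nabla p (a *: u + v) Y = a *: nabla p u Y + nabla p v Y
    & forall U p v Y Z, open U -> U p -> tangent p v ->
        vfield U Y -> vfield U Z ->
        nabla p v (fun q => Y q + Z q) = nabla p v Y + nabla p v Z] /\
  [/\ forall U p v f Y, open U -> U p -> tangent p v ->
        smooth_on U f -> vfield U Y ->
        nabla p v (fun q => f q *: Y q) = v f *: Y p + f p *: nabla p v Y,
      forall U p v Y Z, open U -> U p -> tangent p v ->
        vfield U Y -> vfield U Z -> (forall q, U q -> Y q = Z q) ->
        nabla p v Y = nabla p v Z
    & forall U X Y, open U -> vfield U X -> vfield U Y ->
        vfield U (fun p => nabla p (X p) Y)].

Definition torsion (nabla : M -> tvec -> field -> tvec) X Y : field :=
  fun p => nabla p (X p) Y - nabla p (Y p) X - bracket X Y p.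

Definition curvature (nabla : M -> tvec -> field -> tvec) X Y Z : field :=
  fun p => nabla p (X p) (fun q => nabla q (Y q) Z)
         - nabla p (Y p) (fun q => nabla q (X q) Z)
         - nabla p (bracket X Y p) Z.

Definition hessian (nabla : M -> tvec -> field -> tvec) h X Y p : R :=
  X p (fun q => Y q h) - nabla p (X p) Y h.

(* Endomorphisms of a subbundle H of the tangent bundle are represented by maps
   on all of [tvec], of which only the restriction to H p matters. *)
Definition hendo (H : M -> set tvec) p (A : tvec -> tvec) : Prop :=
  (forall u, H p u -> H p (A u)) /\
  (forall (a : R) u v, H p u -> H p v -> A (a *: u + v) = a *: A u + A v).

Definition hfield (H : M -> set tvec) U X : Prop :=
  vfield U X /\ (forall p, U p -> H p (X p)).

Definition hendo_field (H : M -> set tvec) U (A : M -> tvec -> tvec) : Prop :=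
  (forall p, U p -> hendo H p (A p)) /\
  (forall W X, open W -> W `<=` U -> hfield H W X ->
     hfield H W (fun q => A q (X q))).

Definition hmetric (H : M -> set tvec) (g : M -> tvec -> tvec -> R) : Prop :=
  [/\ forall p u v, H p u -> H p v -> g p u v = g p v u,
      forall p (a : R) u v w, H p u -> H p v -> H p w ->
        g p (a *: u + v) w = a * g p u w + g p v w,
      forall p u, H p u -> u != 0 -> 0 < g p u u
    & forall U X Y, open U -> hfield H U X -> hfield H U Y ->
        smooth_on U (fun q => g q (X q) (Y q))].

End Calculus.

Arguments tvec {R m} M.
Arguments field {R m} M.

Definition s1 : 'I_3 := @Ordinal 3 0 isT.
Definition s2 : 'I_3 := @Ordinal 3 1 isT.
Definition s3 : 'I_3 := @Ordinal 3 2 isT.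

(* Local data (eta, I) on U for a horizontal distribution H, a metric g on H
   and a bundle Q of endomorphisms of H. *)
Record qc_local (R : realType) (m : nat) (M : manifold R m)
    (H : M -> set (tvec M)) (g : M -> tvec M -> tvec M -> R)
    (Q : M -> set (tvec M -> tvec M)) (U : set M)
    (eta : 'I_3 -> M -> tvec M -> R)
    (I : 'I_3 -> M -> tvec M -> tvec M) : Prop := QcLocal {
  qcl_oneform : forall s, oneform U (eta s);
  qcl_codim3 : forall p, U p -> forall c : 'I_3 -> R,
    exists2 v, tangent p v & forall s, eta s p v = c s;
  qcl_kernel : forall p, U p -> forall v,
    H p v <-> tangent p v /\ forall s, eta s p v = 0;
  qcl_hendo : forall s, hendo_field H U (I s);
  qcl_square : forall s p u, U p -> H p u -> I s p (I s p u) = - u;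
  qcl_I12 : forall p u, U p -> H p u -> I s1 p (I s2 p u) = I s3 p u;
  qcl_I21 : forall p u, U p -> H p u -> I s2 p (I s1 p u) = - I s3 p u;
  qcl_I123 : forall p u, U p -> H p u -> I s1 p (I s2 p (I s3 p u)) = - u;
  qcl_isometry : forall s p u v, U p -> H p u -> H p v ->
    g p (I s p u) (I s p v) = g p u v;
  qcl_deta : forall s W X Y, open W -> W `<=` U ->
    hfield H W X -> hfield H W Y ->
    forall p, W p -> 2 * g p (I s p (X p)) (Y p) = dform (eta s) X Y p;
  qcl_Q : forall p, U p -> forall A, Q p A <->
    exists c : 'I_3 -> R, forall u, H p u -> A u = \sum_s c s *: I s p u }.

Record reeb (R : realType) (m : nat) (M : manifold R m)
    (H : M -> set (tvec M)) (U : set M) (eta : 'I_3 -> M -> tvec M -> R)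
    (xi : 'I_3 -> field M) : Prop := Reeb {
  reeb_vfield : forall s, vfield U (xi s);
  reeb_dual : forall s k p, U p -> eta s p (xi k p) = (s == k)%:R;
  reeb_diag : forall s W X, open W -> W `<=` U -> hfield H W X ->
    forall p, W p -> dform (eta s) (xi s) X p = 0;
  reeb_skew : forall s k W X, open W -> W `<=` U -> hfield H W X ->
    forall p, W p -> dform (eta k) (xi s) X p = - dform (eta s) (xi k) X p }.

Record qc_structure (R : realType) (n : nat) (M : manifold R (4 * n).+3) :=
  QcStructure {
  qcH : M -> set (tvec M);
  qcg : M -> tvec M -> tvec M -> R;
  qcQ : M -> set (tvec M -> tvec M);
  qc_metric : hmetric qcH qcg;
  qc_locally : forall p, exists U eta I,
    [/\ open U, U p, qc_local qcH qcg qcQ U eta I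
      & n = 1%N -> exists xi, reeb qcH U eta xi] }.

Section QC.
Context {R : realType} {n : nat} {M : manifold R (4 * n).+3}
  (S : qc_structure M).
Implicit Types (U W : set M) (p : M) (h : M -> R) (X Y : field M)
  (eta : 'I_3 -> M -> tvec M -> R) (I : 'I_3 -> M -> tvec M -> tvec M)
  (xi : 'I_3 -> field M) (e : 'I_(4 * n) -> field M)
  (nabla : M -> tvec M -> field M -> tvec M).

Local Notation H := (qcH S).
Local Notation g := (qcg S).
Local Notation Q := (qcQ S).

Definition qc_reeb_frame U eta I xi : Prop :=
  qc_local H g Q U eta I /\ reeb H U eta xi.

Definition orthonormal_hframe U e : Prop :=
  [/\ forall a, hfield H U (e a),
      forall a b p, U p -> g p (e a p) (e b p) = (a == b)%:R
    & forall p v, U p -> H p v ->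
        exists c : 'I_(4 * n) -> R, v = \sum_a c a *: e a p].

Definition vertical xi p : set (tvec M) :=
  [set v | exists c : 'I_3 -> R, v = \sum_s c s *: xi s p].

Definition proj_V eta xi p (u : tvec M) : tvec M :=
  \sum_s eta s p u *: xi s p.

(* g extended to TM = H (+) V by V _|_ H and g(xi_s, xi_k) = delta_sk *)
Definition g_ext eta xi p (u v : tvec M) : R :=
  g p (u - proj_V eta xi p u) (v - proj_V eta xi p v)
  + \sum_s eta s p u * eta s p v.

Definition sp_n I p (A : tvec M -> tvec M) : Prop :=
  [/\ hendo H p A,
      forall u v, H p u -> H p v -> g p (A u) v = - g p u (A v)
    & forall s u, H p u -> A (I s p u) = I s p (A u)].

Definition sp_n_plus_sp_1 I p (B : tvec M -> tvec M) : Prop :=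
  exists A (c : 'I_3 -> R), sp_n I p A /\
    forall u, H p u -> B u = A u + \sum_s c s *: I s p u.

(* the identification V -> Q mapping xi_s to I_s *)
Definition phi eta I p (v : tvec M) : tvec M -> tvec M :=
  fun u => \sum_s eta s p v *: I s p u.

Record biquard nabla : Prop := Biquard {
  biq_connection : connection nabla;
  biq_H : forall U p v X, open U -> U p -> tangent p v -> hfield H U X ->
    H p (nabla p v X);
  biq_V : forall U eta I xi, open U -> qc_reeb_frame U eta I xi ->
    forall p v Z, U p -> tangent p v -> hfield (vertical xi) U Z ->
    vertical xi p (nabla p v Z);
  biq_metric : forall U p v X Y, open U -> U p -> tangent p v ->
    hfield H U X -> hfield H U Y ->
    v (fun q => g q (X q) (Y q))
      = g p (nabla p v X) (Y p) + g p (X p) (nabla p v Y);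
  (* nabla_v sigma is the endomorphism
     X |-> nabla_v (sigma X) - sigma (nabla_v X) *)
  biq_Q : forall U p v sigma, open U -> U p -> tangent p v ->
    hendo_field H U sigma -> (forall q, U q -> Q q (sigma q)) ->
    exists2 B, Q p B & forall W X, open W -> W p -> W `<=` U -> hfield H W X ->
      nabla p v (fun q => sigma q (X q)) - sigma p (nabla p v X) = B (X p);
  biq_torsion_H : forall U eta I xi, open U -> qc_reeb_frame U eta I xi ->
    forall p X Y, U p -> hfield H U X -> hfield H U Y ->
    torsion nabla X Y p = - proj_V eta xi p (bracket X Y p);
  biq_torsion_V_endo : forall U eta I xi, open U -> qc_reeb_frame U eta I xi ->
    forall p Z X, U p -> hfield (vertical xi) U Z -> hfield H U X ->
    H p (torsion nabla Z X p);
  biq_torsion_V_perp : forall U eta I xi, open U -> qc_reeb_frame U eta I xi ->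
    forall e p Z B, orthonormal_hframe U e -> U p ->
    hfield (vertical xi) U Z -> sp_n_plus_sp_1 I p B ->
    \sum_a g p (torsion nabla Z (e a) p) (B (e a p)) = 0;
  biq_phi : forall U eta I xi, open U -> qc_reeb_frame U eta I xi ->
    forall p v Z X, U p -> tangent p v ->
    hfield (vertical xi) U Z -> hfield H U X ->
    nabla p v (fun q => phi eta I q (Z q) (X q))
      - phi eta I p (Z p) (nabla p v X)
    = phi eta I p (nabla p v Z) (X p) }.

(* horizontal gradient *)
Definition hgrad h : field M := fun p =>
  xget 0 [set v : tvec M | H p v /\ forall u, H p u -> g p v u = u h].

Definition sublaplacian nabla e h p : R :=
  - \sum_a hessian nabla h (e a) (e a) p.

Definition hess_norm2 nabla e h p : R :=
  \sum_a \sum_b hessian nabla h (e a) (e b) p ^+ 2.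

Definition hgrad_norm2 e h p : R := \sum_a e a p h ^+ 2.

Definition torsion3 nabla eta xi X Y (Z : field M) p : R :=
  g_ext eta xi p (torsion nabla X Y p) (Z p).

Definition curvature4 nabla eta xi X Y (Z Z' : field M) p : R :=
  g_ext eta xi p (curvature nabla X Y Z p) (Z' p).

Definition qc_Ric nabla eta xi e X Y p : R :=
  \sum_b curvature4 nabla eta xi (e b) X Y (e b) p.

End QC.

(* Main.v *)
Require Import Defs.
From HB Require Import structures.
From mathcomp Require Import all_boot all_order all_algebra.
From mathcomp Require Import all_classical all_reals all_analysis.
From mathcomp Require Import ring lra.
Import Order.TTheory GRing.Theory Num.Theory.
Import numFieldNormedType.Exports.
Local Open Scope classical_set_scope.
Local Open Scope ring_scope.

(** Write [F] for the horizontal gradient of [f], and [<u, v>] for the metric.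
    As the connection is metric, the Hessian of [f] is [<nabla_u F, v>].

    In a Riemannian manifold the Bochner formula compares the divergence of
    [nabla_F F], which is half the gradient of [|F|^2], with the trace of
    [nabla_F (nabla F)].  Commuting the two derivatives produces the Ricci
    term.  Here the same computation is made with the Biquard connection, and
    its torsion contributes at each place where two derivatives are exchanged.

    The torsion of two horizontal vectors is vertical, with components
    [2 <I_s u, v>] along [xi_s] (lemma [torsion_horizontal]).  So
    - the Hessian is not symmetric: its skew part involves the Reeb derivatives
      [xi_s f] ([hessian_antisym]);
    - half the gradient of [|F|^2] is [nabla_F F + 2 sum_s (xi_s f) I_s F]
      ([hgrad_norm2_hgrad]), and the left-hand side is the divergence of this
      field ([half_sublaplacian_norm2]);
    - the commutation of derivatives produces, besides the Ricci term, the
      terms [(xi_s f) tr (I_s o nabla F)] and [<nabla_(xi_s) F, I_s F>]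
      ([weitzenboeck]).

    The divergence of [(xi_s f) I_s F] is the sum of [(I_s F)(xi_s f)], of
    [(xi_s f) tr (I_s o nabla F)], which also occurs on the other side, and of
    a term in the derivatives of [I_s].  As [nabla] commutes with the
    identification of [xi_s] with [I_s], these derivatives are governed by the
    connection form of the frame [xi], which is skew; so the last term is
    minus the sum of the [(nabla_(I_s F) xi_s) f] ([div_I]).  What remains is
    twice the sum over [s] of the Hessians of [f] at [(I_s F, xi_s)] and at
    [(xi_s, I_s F)], the latter from [weitzenboeck].  Exchanging the arguments
    of the former costs [T(xi_s, I_s F, F)] ([torsion_reeb]), which gives the
    last two sums of the formula. *)

Set Implicit Arguments.
Unset Strict Implicit.
Unset Printing Implicit Defensive.

(** * Smooth functions on open sets of a normed space *)

Section SmoothFunctions.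
Context {R : realType} {E : normedModType R}.
Implicit Types (U W : set E) (f g : E -> R) (k : nat).

Lemma near_eq_differentiable f g (x : E) :
  (\forall y \near x, f y = g y) -> differentiable f x -> differentiable g x.
Proof.
move=> fg /[dup] df /diff_locallyP [dc dxf].
have fgx : f x = g x by exact: nbhs_singleton fg.
have gE : g \o shift x = cst (g x) + 'd f x +o_ (0 : E) id.
  apply/eqaddoP => _/posnumP[eps].
  move/eqaddoP: dxf => /(_ _ (gt0 eps)) dxf; rewrite -fgx.
  have fg0 : \forall h \near (0 : E), f (h + x) = g (h + x).
    by move: fg; rewrite (near_shift 0) subr0.
  near=> h; rewrite !fctE -(near fg0 h)//; near: h.
  exact: dxf.
have dg := diff_unique dc gE.
by apply/diff_locallyP; rewrite dg.
Unshelve. all: by end_near. Qed.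

Lemma open_near_eq U f g x : open U -> U x -> (forall y, U y -> f y = g y) ->
  \forall y \near x, f y = g y.
Proof. by move=> oU Ux fg; apply: filterS (open_nbhs_nbhs (conj oU Ux)). Qed.

Lemma Ck_ext k U f g : open U -> (forall x, U x -> f x = g x) ->
  Ck k U f -> Ck k U g.
Proof.
move=> oU; elim: k f g => [|k IHk] f g fg /=.
  move=> fc x Ux; have fgx := open_near_eq oU Ux fg.
  have gE : g @ x --> f x by apply: cvg_trans (fc x Ux); exact: near_eq_cvg.
  by rewrite fg in gE.
move=> [df dvf]; split=> [x Ux|v].
  by apply: near_eq_differentiable (df x Ux); exact: open_near_eq fg.
apply: IHk (dvf v) => x Ux; apply: near_eq_derive.
exact: open_near_eq fg.
Qed.

Lemma Ck_subset k U W f : W `<=` U -> Ck k U f -> Ck k W f.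
Proof.
move=> WU; elim: k f => [|k IHk] f /=; first by move=> h x /WU; exact: h.
by move=> [df dvf]; split=> [x /WU|v]; [exact: df|exact: IHk].
Qed.

Lemma CkW k U f : Ck k.+1 U f -> Ck k U f.
Proof.
elim: k f => [|k IHk] f [df dvf]; last by split=> // v; exact: IHk.
by move=> x Ux; apply: differentiable_continuous; exact: df.
Qed.

Lemma CkD k U f g : open U -> Ck k U f -> Ck k U g ->
  Ck k U (fun x => f x + g x).
Proof.
move=> oU; elim: k f g => [|k IHk] f g /=.
  by move=> fc gc x Ux; apply: continuousD; [exact: fc|exact: gc].
move=> [df dvf] [dg dvg]; split=> [x Ux|v].
  by apply: differentiableD; [exact: df|exact: dg].
apply: Ck_ext (IHk _ _ (dvf v) (dvg v)) => // x Ux.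
by rewrite -deriveD//; apply: diff_derivable; [exact: df|exact: dg].
Qed.

(** One factor stays undifferentiated in each term of the Leibniz rule, so
    the induction also uses that regularity [k.+1] implies regularity [k]. *)
Lemma CkM k U f g : open U -> Ck k U f -> Ck k U g ->
  Ck k U (fun x => f x * g x).
Proof.
move=> oU; elim: k f g => [|k IHk] f g.
  by move=> fc gc x Ux; apply: continuousM; [exact: fc|exact: gc].
move=> /[dup] /CkW fk [df dvf] /[dup] /CkW gk [dg dvg]; split=> [x Ux|v].
  by apply: differentiableM; [exact: df|exact: dg].
apply: Ck_ext (CkD oU (IHk _ _ fk (dvg v)) (IHk _ _ gk (dvf v))) => // x Ux.
by rewrite -deriveM//; apply: diff_derivable; [exact: df|exact: dg].
Qed.

Lemma Ck_cst k U (c : R) : Ck k U (fun=> c).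
Proof.
elim: k c => [|k IHk] c /=; first by move=> x _; exact: cst_continuous.
split=> [x _|v]; first exact: differentiable_cst.
suff -> : (fun x : E => 'D_v (fun=> c) x) = (fun=> 0) by exact: IHk.
by apply/funext => x; rewrite derive_cst.
Qed.

End SmoothFunctions.

(** * Smooth functions on a manifold *)

Section SmoothOnManifold.
Context {R : realType} {m : nat} {M : manifold R m}.
Implicit Types (U W : set M) (p q : M) (f h : M -> R).

(** Inside the image of the chart, the image of [W] is its preimage by the
    continuous inverse of the chart. *)
Lemma chart_image_open (c : chart R m M) W :
  open W -> open (chart_map c @` (chart_dom c `&` W)).
Proof.
move=> oW.
have -> : chart_map c @` (chart_dom c `&` W) =
    (chart_map c @` chart_dom c) `&` chart_inv c @^-1` W.
  apply/seteqP; split=> [_ [q [cq Wq] <-]|_ [[q cq <-]]] /=.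
    by rewrite chart_mapK//; split=> //; exists q.
  by rewrite chart_mapK// => Wq; exists q.
rewrite openE => x [cx Wx]; apply: filterI.
  by apply: open_nbhs_nbhs; split=> //; exact: chart_img_open.
apply: (chart_inv_continuous cx).
exact: open_nbhs_nbhs.
Qed.

Lemma smooth_on_ext U f h : open U -> (forall q, U q -> f q = h q) ->
  smooth_on U f -> smooth_on U h.
Proof.
move=> oU fh sf c ac k.
apply: Ck_ext (sf c ac k); first exact: chart_image_open.
by move=> _ [q [cq Uq] <-]; rewrite chart_mapK// fh.
Qed.

Lemma smooth_onW U W f : W `<=` U -> smooth_on U f -> smooth_on W f.
Proof.
move=> WU sf c ac k; apply: Ck_subset (sf c ac k).
by apply: image_subset; exact: setIS.
Qed.

Lemma smooth_onD U f h : open U -> smooth_on U f -> smooth_on U h ->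
  smooth_on U (fun q => f q + h q).
Proof.
by move=> oU sf sh c ac k; apply: CkD;
  [exact: chart_image_open|exact: sf|exact: sh].
Qed.

Lemma smooth_onM U f h : open U -> smooth_on U f -> smooth_on U h ->
  smooth_on U (fun q => f q * h q).
Proof.
by move=> oU sf sh c ac k; apply: CkM;
  [exact: chart_image_open|exact: sf|exact: sh].
Qed.

Lemma smooth_on_cst U (a : R) : smooth_on U (fun=> a).
Proof. by move=> c _ k; exact: Ck_cst. Qed.

Lemma smooth_on_sum (J : Type) (r : seq J) U (F : J -> M -> R) : open U ->
  (forall j, smooth_on U (F j)) -> smooth_on U (fun q => \sum_(j <- r) F j q).
Proof.
move=> oU sF; elim: r => [|j r IHr].
  refine (smooth_on_ext oU _ (smooth_on_cst U (0 : R))) => q _.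
  by rewrite big_nil.
refine (smooth_on_ext oU _ (smooth_onD oU (sF j) IHr)) => q _.
by rewrite big_cons.
Qed.

Lemma smooth_onN U f : open U -> smooth_on U f -> smooth_on U (fun q => - f q).
Proof.
move=> oU sf.
apply: smooth_on_ext (smooth_onM oU (smooth_on_cst U (- 1)) sf) => // q _.
by rewrite mulN1r.
Qed.

Lemma smooth_germ_on U p f : open U -> U p -> smooth_on U f -> smooth_germ p f.
Proof. by exists U. Qed.

End SmoothOnManifold.

(** * Tangent vectors *)

Section TangentVectors.
Context {R : realType} {m : nat} {M : manifold R m}.
Implicit Types (U W : set M) (p q : M) (f h : M -> R) (u v : tvec M)
  (X Y : field M).

Lemma comb_apply (J : Type) (r : seq J) (c : J -> R) (u : J -> tvec M) h :
  (\sum_(j <- r) c j *: u j) h = \sum_(j <- r) c j * u j h :> R.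
Proof. by elim/big_rec2: _ => // j _ w _ <-. Qed.

Section Derivation.
Context {p : M} {v : tvec M} (tv : tangent p v) {U : set M}.
Context (oU : open U) (Up : U p).

(** A tangent vector at [p] sees only germs at [p].  This is how an expression
    that is known on [U] alone is replaced under a derivative. *)
Lemma tangent_ext f h : smooth_on U f -> (forall q, U q -> f q = h q) ->
  v f = v h.
Proof.
move=> sf fh; case: tv => _ _ + _; apply.
- exact: smooth_germ_on sf.
- by apply: (smooth_germ_on oU Up); exact: smooth_on_ext sf.
- by apply: filterS (open_nbhs_nbhs (conj oU Up)).
Qed.

Lemma tangent_lin (a : R) f h : smooth_on U f -> smooth_on U h ->
  v (fun q => a * f q + h q) = a * v f + v h :> R.
Proof.
by move=> sf sh; case: tv => + _ _ _; apply; exact: (smooth_germ_on oU Up).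
Qed.

Lemma tangentD f h : smooth_on U f -> smooth_on U h ->
  v (fun q => f q + h q) = v f + v h :> R.
Proof.
move=> sf sh; rewrite -[v f in RHS]mul1r -tangent_lin//.
by congr v; apply/funext => q; rewrite mul1r.
Qed.

Lemma tangentM f h : smooth_on U f -> smooth_on U h ->
  v (fun q => f q * h q) = v f * h p + f p * v h :> R.
Proof.
by move=> sf sh; case: tv => _ + _ _; apply; exact: (smooth_germ_on oU Up).
Qed.

Lemma tangent_cst (a : R) : v (fun=> a) = 0 :> R.
Proof.
have s b : smooth_on U (fun=> b : R) by exact: smooth_on_cst.
have v0 : v (fun=> 0) = 0 :> R.
  have := tangent_lin (- 1) (s 0) (s 0); rewrite mulr0 addr0 => ->.
  by rewrite mulN1r addNr.
(* the Leibniz rule for 1 * 1 gives v 1 = v 1 + v 1 *)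
have v1 : v (fun=> 1) = 0 :> R.
  have := tangentM (s 1) (s 1); rewrite !mulr1 mul1r => /eqP.
  by rewrite -subr_eq0 opprD addNKr oppr_eq0 => /eqP.
have := tangent_lin a (s 1) (s 0).
by rewrite mulr1 addr0 v0 v1 mulr0 addr0.
Qed.

Lemma tangentN f : smooth_on U f -> v (fun q => - f q) = - v f :> R.
Proof.
move=> sf; have := tangent_lin (- 1) sf (smooth_on_cst U 0).
rewrite tangent_cst addr0 mulN1r => <-.
by congr v; apply/funext => q; rewrite mulN1r addr0.
Qed.

Lemma tangent_sum (J : Type) (r : seq J) (F : J -> M -> R) :
  (forall j, smooth_on U (F j)) ->
  v (fun q => \sum_(j <- r) F j q) = \sum_(j <- r) (v (F j) : R) :> R.
Proof.
move=> sF; elim: r => [|j r IHr].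
  rewrite big_nil -[RHS](tangent_cst 0); congr v.
  by apply/funext => q; rewrite big_nil.
rewrite big_cons -IHr -tangentD//; last exact: smooth_on_sum.
by congr v; apply/funext => q; rewrite big_cons.
Qed.

End Derivation.

Lemma tangent_comb p (a : R) u v :
  tangent p u -> tangent p v -> tangent p (a *: u + v).
Proof.
have uvE h : (a *: u + v) h = a * u h + v h :> R by [].
move=> [ul um ue u0] [vl vm ve v0]; split.
- move=> b f h sf sh; rewrite !uvE ul// vl//.
  ring.
- move=> f h sf sh; rewrite !uvE um// vm//.
  ring.
- by move=> f h sf sh fh; rewrite !uvE (ue f h)// (ve f h).
- by move=> f sf; rewrite uvE u0// v0// mulr0 addr0.
Qed.

Lemma tangent0 p : tangent p (0 : tvec M).
Proof.
have zE h : (0 : tvec M) h = 0 :> R by [].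
by split=> // [a f h _ _|f h _ _]; rewrite !zE ?mul0r !mulr0 addr0.
Qed.

Lemma tangentZ p (a : R) v : tangent p v -> tangent p (a *: v).
Proof.
by move=> tv; rewrite -[a *: v]addr0; exact: tangent_comb tv (tangent0 p).
Qed.

Lemma tangentDv p u v : tangent p u -> tangent p v -> tangent p (u + v).
Proof. by move=> tu tv; rewrite -[u]scale1r; exact: tangent_comb. Qed.

Lemma tangentBv p u v : tangent p u -> tangent p v -> tangent p (u - v).
Proof. by move=> tu tv; rewrite addrC -scaleN1r; exact: tangent_comb. Qed.

Lemma tangent_sumv p (J : Type) (r : seq J) (u : J -> tvec M) :
  (forall j, tangent p (u j)) -> tangent p (\sum_(j <- r) u j).
Proof.
move=> tu; elim: r => [|j r IHr]; first by rewrite big_nil; exact: tangent0.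
by rewrite big_cons; exact: tangentDv.
Qed.

End TangentVectors.

(** * Vector fields *)

Section VectorFields.
Context {R : realType} {m : nat} {M : manifold R m} {U : set M}.
Context (oU : open U).
Implicit Types (p q : M) (f h : M -> R) (X Y : field M).

Lemma vfield_smooth X f : vfield U X -> smooth_on U f ->
  smooth_on U (fun q => X q f).
Proof. by move=> [_ sX]; exact: sX. Qed.

Lemma vfield_ext X Y : (forall q, U q -> X q = Y q) -> vfield U X -> vfield U Y.
Proof.
move=> XY [tX sX]; split=> [q Uq|W f oW WU sf].
  by rewrite -XY//; exact: tX.
apply: smooth_on_ext (sX _ _ oW WU sf) => // q Wq.
by rewrite XY//; exact: WU.
Qed.

Lemma vfieldZ f X : smooth_on U f -> vfield U X ->
  vfield U (fun q => f q *: X q).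
Proof.
move=> sf [tX sX]; split=> [q Uq|W h oW WU sh].
  by apply: tangentZ; exact: tX.
by apply: smooth_onM => //; [exact: smooth_onW sf|exact: sX].
Qed.

Lemma vfieldD X Y : vfield U X -> vfield U Y -> vfield U (fun q => X q + Y q).
Proof.
move=> [tX sX] [tY sY]; split=> [q Uq|W h oW WU sh].
  by apply: tangentDv; [exact: tX|exact: tY].
by apply: smooth_onD => //; [exact: sX|exact: sY].
Qed.

Lemma vfield0 : vfield U (fun=> 0).
Proof.
by split=> [q _|W h _ _ _]; [exact: tangent0|exact: smooth_on_cst].
Qed.

Lemma vfield_sum (J : Type) (r : seq J) (X : J -> field M) :
  (forall j, vfield U (X j)) -> vfield U (fun q => \sum_(j <- r) X j q).
Proof.
move=> vX; elim: r => [|j r IHr].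
  by apply: vfield_ext vfield0 => q _; rewrite big_nil.
by apply: vfield_ext (vfieldD (vX j) IHr) => q _; rewrite big_cons.
Qed.

Lemma bracketE X Y p f : U p -> smooth_on U f ->
  bracket X Y p f = X p (fun q => Y q f) - Y p (fun q => X q f) :> R.
Proof.
move=> Up sf; rewrite /bracket ifT//; apply/asboolP.
exact: smooth_germ_on sf.
Qed.

End VectorFields.

(** * Affine connections *)

Section Connection.
Context {R : realType} {m : nat} {M : manifold R m}
  {nabla : M -> tvec M -> field M -> tvec M} (cn : connection nabla)
  {U : set M} (oU : open U).
Implicit Types (p q : M) (f h : M -> R) (u v : tvec M) (X Y : field M).

Lemma nabla_tangent p v Y : U p -> tangent p v -> vfield U Y ->
  tangent p (nabla p v Y).
Proof. by move=> Up tv vY; case: cn => -[h _ _] _; exact: (h U). Qed.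

Lemma nabla_vfield X Y : vfield U X -> vfield U Y ->
  vfield U (fun q => nabla q (X q) Y).
Proof. by move=> vX vY; case: cn => _ [_ _ h]; exact: h. Qed.

Lemma nabla_ext p v X Y : U p -> tangent p v -> vfield U X ->
  (forall q, U q -> X q = Y q) -> nabla p v X = nabla p v Y.
Proof.
move=> Up tv vX XY; case: cn => _ [_ h _]; apply: (h U) => //.
exact: vfield_ext vX.
Qed.

Lemma nabla_comb p (a : R) u v Y : U p -> tangent p u -> tangent p v ->
  vfield U Y -> nabla p (a *: u + v) Y = a *: nabla p u Y + nabla p v Y.
Proof. by move=> Up tu tv vY; case: cn => -[_ h _] _; exact: (h U). Qed.

Lemma nabla_dir0 p Y : U p -> vfield U Y -> nabla p 0 Y = 0.
Proof.
move=> Up vY; have := nabla_comb (- 1) Up (tangent0 p) (tangent0 p) vY.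
by rewrite scaler0 addr0 scaleN1r addNr.
Qed.

Lemma nabla_dirD p u v Y : U p -> tangent p u -> tangent p v ->
  vfield U Y -> nabla p (u + v) Y = nabla p u Y + nabla p v Y.
Proof. by move=> Up tu tv vY; rewrite -[u]scale1r nabla_comb// !scale1r. Qed.

Lemma nabla_dirZ p (a : R) u Y : U p -> tangent p u -> vfield U Y ->
  nabla p (a *: u) Y = a *: nabla p u Y.
Proof.
move=> Up tu vY; rewrite -[a *: u in LHS]addr0.
by rewrite nabla_comb// ?nabla_dir0// ?addr0//; exact: tangent0.
Qed.

Lemma nabla_dirB p u v Y : U p -> tangent p u -> tangent p v ->
  vfield U Y -> nabla p (u - v) Y = nabla p u Y - nabla p v Y.
Proof.
move=> Up tu tv vY; rewrite -scaleN1r nabla_dirD ?nabla_dirZ ?scaleN1r//.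
by rewrite -scaleN1r; exact: tangentZ.
Qed.

Lemma nabla_dir_sum p (J : Type) (r : seq J) (c : J -> R) (u : J -> tvec M) Y :
  U p -> (forall j, tangent p (u j)) -> vfield U Y ->
  nabla p (\sum_(j <- r) c j *: u j) Y = \sum_(j <- r) c j *: nabla p (u j) Y.
Proof.
move=> Up tu vY; elim: r => [|j r IHr]; first by rewrite !big_nil nabla_dir0.
rewrite !big_cons nabla_comb// ?IHr//.
by apply: tangent_sumv => k; exact: tangentZ.
Qed.

Lemma nabla_fieldD p v X Y : U p -> tangent p v -> vfield U X -> vfield U Y ->
  nabla p v (fun q => X q + Y q) = nabla p v X + nabla p v Y.
Proof. by move=> Up tv vX vY; case: cn => -[_ _ h] _; exact: (h U). Qed.

Lemma nabla_leibniz p v f Y : U p -> tangent p v -> smooth_on U f ->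
  vfield U Y ->
  nabla p v (fun q => f q *: Y q) = v f *: Y p + f p *: nabla p v Y.
Proof. by move=> Up tv sf vY; case: cn => _ [h _ _]; exact: (h U). Qed.

Lemma nabla_fieldZ p v (a : R) Y : U p -> tangent p v -> vfield U Y ->
  nabla p v (fun q => a *: Y q) = a *: nabla p v Y.
Proof.
move=> Up tv vY; rewrite (nabla_leibniz (f := fun=> a))//; last first.
  exact: smooth_on_cst.
by rewrite (tangent_cst tv oU Up) scale0r add0r.
Qed.

Lemma nabla_field_sum p v (J : Type) (r : seq J) (Y : J -> field M) :
  U p -> tangent p v -> (forall j, vfield U (Y j)) ->
  nabla p v (fun q => \sum_(j <- r) Y j q) = \sum_(j <- r) nabla p v (Y j).
Proof.
move=> Up tv vY; elim: r => [|j r IHr].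
  rewrite big_nil -[RHS](scale0r (nabla p v (fun=> 0))).
  rewrite -nabla_fieldZ//; last exact: vfield0.
  apply: nabla_ext => // [|q _]; last by rewrite big_nil scaler0.
  by apply: vfield_ext (@vfield0 _ _ _ _) => q _; rewrite big_nil.
rewrite big_cons -IHr -nabla_fieldD//; last exact: vfield_sum.
apply: nabla_ext => // [|q _]; last by rewrite big_cons.
exact: vfield_sum.
Qed.

End Connection.

(** * Linear algebra of the horizontal space *)

Lemma ord3_ind (P : 'I_3 -> Prop) : P s1 -> P s2 -> P s3 -> forall s, P s.
Proof.
by move=> P1 P2 P3 [[|[|[|//]]] i];
  [rewrite (_ : Ordinal i = s1)|rewrite (_ : Ordinal i = s2)
  |rewrite (_ : Ordinal i = s3)] => //; exact: val_inj.
Qed.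

Section Horizontal.
Context {R : realType} {n : nat} {M : manifold R (4 * n).+3}
  {S : qc_structure M}.
Local Notation H := (qcH S).
Local Notation g := (qcg S).
Context {U : set M} (oU : open U) {eta : 'I_3 -> M -> tvec M -> R}
  {I : 'I_3 -> M -> tvec M -> tvec M} {xi : 'I_3 -> field M}
  (hxi : qc_reeb_frame S U eta I xi).
Implicit Types (p q : M) (f h : M -> R) (u v w : tvec M) (X Y : field M)
  (s t : 'I_3).

Let qcl : qc_local H g (qcQ S) U eta I := hxi.1.

Lemma eta_comb s p (a : R) u v : U p -> tangent p u -> tangent p v ->
  eta s p (a *: u + v) = a * eta s p u + eta s p v.
Proof. by move=> Up tu tv; apply: (qcl_oneform qcl s).1. Qed.

Lemma eta0 s p : U p -> eta s p 0 = 0.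
Proof.
move=> Up; have := eta_comb s (- 1) Up (tangent0 p) (tangent0 p).
by rewrite scaler0 addr0 mulN1r addNr.
Qed.

Lemma eta_sum s p (J : Type) (r : seq J) (c : J -> R) (u : J -> tvec M) :
  U p -> (forall j, tangent p (u j)) ->
  eta s p (\sum_(j <- r) c j *: u j) = \sum_(j <- r) c j * eta s p (u j).
Proof.
move=> Up tu; elim: r => [|j r IHr]; first by rewrite !big_nil eta0.
rewrite !big_cons eta_comb ?IHr//.
by apply: tangent_sumv => k; exact: tangentZ.
Qed.

Lemma reeb_tangent s p : U p -> tangent p (xi s p).
Proof. exact: (reeb_vfield hxi.2 s).1. Qed.

Lemma H_tangent p v : U p -> H p v -> tangent p v.
Proof. by move=> Up /(qcl_kernel qcl Up)[]. Qed.

Lemma eta_H s p v : U p -> H p v -> eta s p v = 0.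
Proof. by move=> Up /(qcl_kernel qcl Up)[]. Qed.

Lemma H_comb p (a : R) u v : U p -> H p u -> H p v -> H p (a *: u + v).
Proof.
move=> Up Hu Hv; apply/(qcl_kernel qcl Up); split.
  by apply: tangent_comb; exact: H_tangent.
move=> s; rewrite eta_comb//; try exact: H_tangent.
by rewrite !eta_H// mulr0 addr0.
Qed.

Lemma H_zero p : U p -> H p 0.
Proof.
move=> Up; apply/(qcl_kernel qcl Up); split; first exact: tangent0.
by move=> s; rewrite eta0.
Qed.

Lemma H_scale p (a : R) u : U p -> H p u -> H p (a *: u).
Proof.
by move=> Up Hu; rewrite -[_ *: _]addr0; apply: H_comb => //; exact: H_zero.
Qed.

Lemma H_add p u v : U p -> H p u -> H p v -> H p (u + v).
Proof. by move=> Up Hu Hv; rewrite -[u]scale1r; exact: H_comb. Qed.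

Lemma H_sub p u v : U p -> H p u -> H p v -> H p (u - v).
Proof. by move=> Up Hu Hv; rewrite addrC -scaleN1r; exact: H_comb. Qed.

Lemma H_sum p (J : Type) (r : seq J) (u : J -> tvec M) : U p ->
  (forall j, H p (u j)) -> H p (\sum_(j <- r) u j).
Proof.
move=> Up Hu; elim: r => [|j r IHr]; first by rewrite big_nil; exact: H_zero.
by rewrite big_cons; exact: H_add.
Qed.

Lemma H_I s p u : U p -> H p u -> H p (I s p u).
Proof. by move=> Up; exact: ((qcl_hendo qcl s).1 p Up).1. Qed.

Lemma hfieldI s X : hfield H U X -> hfield H U (fun q => I s q (X q)).
Proof. by move=> hX; apply: (qcl_hendo qcl s).2. Qed.

Lemma hfieldZ f X : smooth_on U f -> hfield H U X ->
  hfield H U (fun q => f q *: X q).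
Proof.
move=> sf [vX HX]; split; first exact: vfieldZ.
by move=> q Uq; apply: H_scale => //; exact: HX.
Qed.

Lemma hfieldD X Y : hfield H U X -> hfield H U Y ->
  hfield H U (fun q => X q + Y q).
Proof.
move=> [vX HX] [vY HY]; split; first exact: vfieldD.
by move=> q Uq; apply: H_add => //; [exact: HX|exact: HY].
Qed.

Lemma hfield_sum (J : Type) (r : seq J) (X : J -> field M) :
  (forall j, hfield H U (X j)) -> hfield H U (fun q => \sum_(j <- r) X j q).
Proof.
move=> hX; split; first by apply: vfield_sum => // j; exact: (hX j).1.
by move=> q Uq; apply: H_sum => // j; exact: (hX j).2.
Qed.

Lemma hfield_tangent X p : hfield H U X -> U p -> tangent p (X p).
Proof. by move=> [[tX _] _]; exact: tX. Qed.

(** * The horizontal metric *)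

Lemma gC p u v : H p u -> H p v -> g p u v = g p v u.
Proof. by case: (qc_metric S) => h _ _ _; exact: h. Qed.

Lemma g_comb p (a : R) u v w : H p u -> H p v -> H p w ->
  g p (a *: u + v) w = a * g p u w + g p v w.
Proof. by case: (qc_metric S) => _ h _ _; exact: h. Qed.

Lemma g_smooth X Y : hfield H U X -> hfield H U Y ->
  smooth_on U (fun q => g q (X q) (Y q)).
Proof. by case: (qc_metric S) => _ _ _ h; exact: h. Qed.

Context {p : M} (Up : U p).

Lemma g0l v : H p v -> g p 0 v = 0.
Proof.
move=> Hv; have := g_comb (- 1) (H_zero Up) (H_zero Up) Hv.
by rewrite scaler0 addr0 mulN1r addNr.
Qed.

Lemma gZl (a : R) u v : H p u -> H p v -> g p (a *: u) v = a * g p u v.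
Proof.
move=> Hu Hv; rewrite -[_ *: _ in LHS]addr0 g_comb//; last exact: H_zero.
by rewrite g0l ?addr0.
Qed.

Lemma gDl u v w : H p u -> H p v -> H p w ->
  g p (u + v) w = g p u w + g p v w.
Proof. by move=> *; rewrite -[u in LHS]scale1r g_comb// mul1r. Qed.

Lemma gNl u v : H p u -> H p v -> g p (- u) v = - g p u v.
Proof. by move=> *; rewrite -scaleN1r gZl// mulN1r. Qed.

Lemma gBl u v w : H p u -> H p v -> H p w ->
  g p (u - v) w = g p u w - g p v w.
Proof. by move=> *; rewrite addrC -scaleN1r g_comb// mulN1r addrC. Qed.

Lemma g_suml (J : Type) (r : seq J) (c : J -> R) (u : J -> tvec M) v :
  (forall j, H p (u j)) -> H p v ->
  g p (\sum_(j <- r) c j *: u j) v = \sum_(j <- r) c j * g p (u j) v.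
Proof.
move=> Hu Hv; elim: r => [|j r IHr]; first by rewrite !big_nil g0l.
rewrite !big_cons g_comb ?IHr//.
by apply: H_sum => // k; exact: H_scale.
Qed.

Lemma gNr u v : H p u -> H p v -> g p u (- v) = - g p u v.
Proof.
move=> Hu Hv; rewrite gC ?gNl 1?gC//.
by rewrite -scaleN1r; exact: H_scale.
Qed.

Lemma g_I_skew s u v : H p u -> H p v -> g p (I s p u) v = - g p u (I s p v).
Proof.
move=> Hu Hv; have HIv := H_I s Up Hv.
have := qcl_isometry qcl s Up Hu HIv.
rewrite (qcl_square qcl)// gNr//; last exact: H_I.
by move=> <-; rewrite opprK.
Qed.

Lemma I_lin s (a : R) u v : H p u -> H p v ->
  I s p (a *: u + v) = a *: I s p u + I s p v.
Proof. exact: ((qcl_hendo qcl s).1 p Up).2. Qed.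

Lemma IN s u : H p u -> I s p (- u) = - I s p u.
Proof.
move=> Hu; rewrite -scaleN1r -[X in I s p X]addr0 I_lin//; last exact: H_zero.
have := I_lin s (- 1) (H_zero Up) (H_zero Up).
by rewrite scaler0 addr0 scaleN1r addNr => ->; rewrite addr0 scaleN1r.
Qed.

(** The structure gives the products of [I s1] and [I s2]; all others follow
    since each [I s] squares to minus the identity. *)
Lemma I_anticomm s t u : s != t -> H p u ->
  I s p (I t p u) = - I t p (I s p u).
Proof.
move=> st Hu.
have I12 v : H p v -> I s1 p (I s2 p v) = I s3 p v by exact: (qcl_I12 qcl).
have I21 v : H p v -> I s2 p (I s1 p v) = - I s3 p v by exact: (qcl_I21 qcl).
have II r v : H p v -> I r p (I r p v) = - v by exact: (qcl_square qcl).
have HI' r v : H p v -> H p (I r p v) by exact: H_I.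
have I31 : I s3 p (I s1 p u) = I s2 p u.
  rewrite -[LHS]opprK -I21; last exact: HI'.
  by rewrite II// IN ?opprK//.
have I13 : I s1 p (I s3 p u) = - I s2 p u.
  by rewrite -I12// II//; exact: HI'.
have I32 : I s3 p (I s2 p u) = - I s1 p u.
  by rewrite -I12 ?II ?IN//; exact: HI'.
have I23 : I s2 p (I s3 p u) = I s1 p u.
  rewrite -[I s3 p u]opprK -I21// IN; last by do 2!apply: (HI' _).
  by rewrite II ?opprK//; exact: HI'.
move: s t st; apply: ord3_ind; apply: ord3_ind => //= _;
  by rewrite ?I12 ?I21 ?I31 ?I13 ?I32 ?I23 ?opprK.
Qed.

(** The three almost complex structures carry a vector to mutually orthogonal
    vectors of the same length, as the [I s] are skew and anticommute. *)
Lemma g_I_orth s t u : H p u ->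
  g p (I s p u) (I t p u) = (s == t)%:R * g p u u.
Proof.
move=> Hu; have [<-|st] := eqVneq s t.
  by rewrite (qcl_isometry qcl)// mul1r.
have HIs := H_I s Up Hu; have HIt := H_I t Up Hu.
have : g p (I s p u) (I t p u) = - g p (I s p u) (I t p u).
  rewrite [LHS]g_I_skew// I_anticomm// gNr//; last exact: (H_I t Up HIs).
  by rewrite [in RHS]gC// (g_I_skew t).
by move/eqP; rewrite -addr_eq0 -mulr2n mulrn_eq0/= mul0r => /eqP.
Qed.

End Horizontal.

(** * Orthonormal frames and horizontal gradients *)

Section Bochner.
Context {R : realType} {n : nat} {M : manifold R (4 * n).+3}
  {S : qc_structure M}.
Local Notation H := (qcH S).
Local Notation g := (qcg S).
Context {nabla : M -> tvec M -> field M -> tvec M} (bq : biquard S nabla)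
  {U : set M} (oU : open U) {eta : 'I_3 -> M -> tvec M -> R}
  {I : 'I_3 -> M -> tvec M -> tvec M} {xi : 'I_3 -> field M}
  (hxi : qc_reeb_frame S U eta I xi) {e : 'I_(4 * n) -> field M}
  (he : orthonormal_hframe S U e).
Implicit Types (p q : M) (f h : M -> R) (u v w : tvec M) (X Y G : field M)
  (s t : 'I_3) (a b : 'I_(4 * n)).

Let qcl : qc_local H g (qcQ S) U eta I := hxi.1.
Let cn : connection nabla := biq_connection bq.

Lemma frame_hfield a : hfield H U (e a).
Proof. by case: he. Qed.

Lemma frame_H a p : U p -> H p (e a p).
Proof. exact: (frame_hfield a).2. Qed.

Lemma frame_tangent a p : U p -> tangent p (e a p).
Proof. exact: (hfield_tangent (frame_hfield a)). Qed.

Lemma frame_expansion p v : U p -> H p v -> v = \sum_a g p v (e a p) *: e a p.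
Proof.
move=> Up Hv; have [_ orth gen] := he.
have [c vE] := gen p v Up Hv; rewrite {1}vE; apply: eq_bigr => a _.
congr (_ *: _); rewrite vE (g_suml hxi)//; last 2 first.
- by move=> b; exact: frame_H.
- exact: frame_H.
by rewrite (bigD1 a)//= orth// eqxx mulr1 big1 ?addr0// => b /negPf ba;
  rewrite orth// ba mulr0.
Qed.

Lemma parseval p u v : U p -> H p u -> H p v ->
  g p u v = \sum_a g p u (e a p) * g p v (e a p).
Proof.
move=> Up Hu Hv; rewrite {1}(frame_expansion Up Hu) (g_suml hxi)//; last first.
  by move=> a; exact: frame_H.
by apply: eq_bigr => a _; rewrite [X in _ * X]gC//; exact: frame_H.
Qed.

(** Torsion and brackets are defined for fields: identities between
    horizontal vectors at a point are reduced to them by extending the vectors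
    with constant coefficients in the frame. *)
Lemma horizontal_extension p v : U p -> H p v ->
  exists2 X, hfield H U X & X p = v.
Proof.
move=> Up Hv; exists (fun q => \sum_a g p v (e a p) *: e a q).
  apply: (hfield_sum hxi) => a; apply: (hfieldZ hxi).
    exact: smooth_on_cst.
  exact: frame_hfield.
by rewrite -frame_expansion.
Qed.

(** The module structure on tangent vectors is pointwise, so [u h] is linear
    in [u] for every function [h], smooth or not, and the representing vector
    is [sum_a (e_a h) e_a]. *)
Lemma hgrad_spec h p : U p ->
  H p (hgrad S h p) /\ forall u, H p u -> g p (hgrad S h p) u = u h.
Proof.
move=> Up; pose P := [set v | H p v /\ forall u, H p u -> g p v u = u h].
suff [v Pv] : exists v, P v by exact: (xgetI 0 Pv).
have Hsum : H p (\sum_a (e a p h : R) *: e a p).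
  by apply: (H_sum hxi) => // a; apply: (H_scale hxi) => //; exact: frame_H.
exists (\sum_a (e a p h : R) *: e a p); split=> // u Hu.
rewrite (g_suml hxi)//; last by move=> a; exact: frame_H.
rewrite [in RHS](frame_expansion Up Hu) comb_apply; apply: eq_bigr => a _.
by rewrite mulrC gC//; exact: frame_H.
Qed.

Lemma hgrad_H h p : U p -> H p (hgrad S h p).
Proof. by move=> /(hgrad_spec h)[]. Qed.

Lemma g_hgrad h p u : U p -> H p u -> g p (hgrad S h p) u = u h.
Proof. by move=> /(hgrad_spec h)[_]; exact. Qed.

Lemma hgrad_hfield h : smooth_on U h -> hfield H U (hgrad S h).
Proof.
move=> sh; split; last by move=> q; exact: hgrad_H.
apply: (vfield_ext (X := fun q => \sum_a (e a q h : R) *: e a q)).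
  move=> q Uq; rewrite [RHS](frame_expansion Uq (hgrad_H h Uq)).
  by apply: eq_bigr => a _; rewrite g_hgrad//; exact: frame_H.
apply: vfield_sum => // a; apply: vfieldZ; last exact: (frame_hfield a).1.
exact: (vfield_smooth oU (frame_hfield a).1).
Qed.

(** A predicate on fields rather than an equation with [hgrad S h]: gradients
    given by a formula represent [dh] on [U] only. *)
Definition is_hgrad h G : Prop :=
  hfield H U G /\ forall q u, U q -> H q u -> u h = g q (G q) u :> R.

Lemma hgradP h : smooth_on U h -> is_hgrad h (hgrad S h).
Proof.
by move=> sh; split=> [|q u Uq Hu]; [exact: hgrad_hfield|rewrite g_hgrad].
Qed.

(** * Horizontal derivatives and torsion *)

Lemma nabla_H p v X : U p -> tangent p v -> hfield H U X -> H p (nabla p v X).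
Proof. by move=> Up tv hX; exact: (biq_H bq oU). Qed.

Lemma nabla_hfield X Y : vfield U X -> hfield H U Y ->
  hfield H U (fun q => nabla q (X q) Y).
Proof.
move=> vX hY; split; first exact: (nabla_vfield cn oU vX hY.1).
by move=> q Uq; apply: nabla_H => //; exact: vX.1.
Qed.

Lemma nabla_metric p v X Y :
  U p -> tangent p v -> hfield H U X -> hfield H U Y ->
  v (fun q => g q (X q) (Y q))
  = g p (nabla p v X) (Y p) + g p (X p) (nabla p v Y) :> R.
Proof. by move=> Up tv hX hY; exact: (biq_metric bq oU). Qed.

(** Metric compatibility turns the Hessian of [h] into the covariant derivative
    of its gradient. *)
Lemma hessian_hgrad h G p v Y : is_hgrad h G -> U p -> tangent p v ->
  hfield H U Y ->
  v (fun q => Y q h) - nabla p v Y h = g p (nabla p v G) (Y p) :> R.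
Proof.
move=> [hG hE] Up tv hY.
have -> : v (fun q => Y q h) = v (fun q => g q (G q) (Y q)).
  apply/esym/(tangent_ext tv oU Up); first exact: g_smooth.
  by move=> q Uq; rewrite (hE q)//; exact: hY.2.
rewrite (nabla_metric Up tv hG hY) (hE p)//; last exact: nabla_H.
by rewrite addrK.
Qed.

Lemma sublaplacian_div h G p : is_hgrad h G -> U p ->
  sublaplacian nabla e h p = - \sum_a g p (nabla p (e a p) G) (e a p).
Proof.
move=> hG Up; congr (- _); apply: eq_bigr => a _.
by rewrite -(hessian_hgrad hG)//; [exact: frame_tangent|exact: frame_hfield].
Qed.

(** As [eta s] vanishes on [X] and [Y], only the bracket term of the exterior
    derivative of [eta s] survives. *)
Lemma eta_bracket s p X Y : U p -> hfield H U X -> hfield H U Y ->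
  eta s p (bracket X Y p) = - (2 * g p (I s p (X p)) (Y p)).
Proof.
move=> Up hX hY.
have const0 Z Z' : hfield H U Z -> hfield H U Z' ->
    Z p (fun q => eta s q (Z' q)) = 0 :> R.
  move=> hZ hZ'; have tZ := hfield_tangent hZ Up.
  rewrite -[RHS](tangent_cst tZ oU Up 0); apply/esym/(tangent_ext tZ oU Up).
    exact: smooth_on_cst.
  by move=> q Uq; rewrite (eta_H hxi)//; exact: hZ'.2.
rewrite (qcl_deta qcl s oU (fun _ Uq => Uq) hX hY Up) /dform !const0//.
by rewrite subrr sub0r opprK.
Qed.

Lemma torsion_horizontal p X Y : U p -> hfield H U X -> hfield H U Y ->
  torsion nabla X Y p = \sum_s (2 * g p (I s p (X p)) (Y p)) *: xi s p.
Proof.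
move=> Up hX hY; rewrite (biq_torsion_H bq oU hxi Up hX hY) /proj_V -sumrN.
by apply: eq_bigr => s _; rewrite eta_bracket// scaleNr opprK.
Qed.

(** * The gradient of the squared length of the gradient *)

Section FixedFunction.
Context {f : M -> R} (sf : smooth_on U f).
Let F := hgrad S f.
Let gradF : is_hgrad f F := hgradP sf.
Let hF : hfield H U F := gradF.1.

Lemma FH p : U p -> H p (F p).
Proof. exact: hF.2. Qed.

Lemma nablaFH p v : U p -> tangent p v -> H p (nabla p v F).
Proof. by move=> Up tv; exact: nabla_H. Qed.

(** Exchanging the arguments of a Hessian costs the torsion, applied to [f]. *)
Lemma hessian_antisym p u v : U p -> H p u -> H p v ->
  g p (nabla p u F) v - g p (nabla p v F) u
  = - \sum_s 2 * g p (I s p u) v * xi s p f :> R.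
Proof.
move=> Up Hu Hv.
have [X hX Xu] := horizontal_extension Up Hu.
have [Y hY Yv] := horizontal_extension Up Hv.
have tX := hfield_tangent hX Up; have tY := hfield_tangent hY Up.
rewrite -Xu -Yv -!(hessian_hgrad gradF)//.
have := congr1 (fun w : tvec M => w f : R) (torsion_horizontal Up hX hY).
rewrite comb_apply => <-.
have -> : torsion nabla X Y p f
  = nabla p (X p) Y f - nabla p (Y p) X f - bracket X Y p f :> R by [].
rewrite (bracketE oU)//; ring.
Qed.

Lemma hgrad_norm2E q : U q -> g q (F q) (F q) = hgrad_norm2 e f q.
Proof.
move=> Uq; rewrite parseval//; try exact: FH.
by apply: eq_bigr => a _; rewrite g_hgrad//; exact: frame_H.
Qed.

(** The derivative of [<F, F>] along [u] is [2 <nabla_u F, F>]; moving [u] to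
    the second argument of the Hessian gives [2 <nabla_F F, u>] and the Reeb
    derivatives. *)
Lemma hgrad_norm2_hgrad : is_hgrad (hgrad_norm2 e f)
  (fun q => 2 *: (nabla q (F q) F
                  + \sum_s (2 * xi s q f) *: I s q (F q))).
Proof.
have sxi s : smooth_on U (fun q => 2 * xi s q f).
  apply: smooth_onM => //; first exact: smooth_on_cst.
  exact: (vfield_smooth oU (reeb_vfield hxi.2 s)).
split.
  apply: (hfieldZ hxi); first exact: smooth_on_cst.
  apply: (hfieldD hxi); first exact: (nabla_hfield hF.1 hF).
  apply: (hfield_sum hxi) => s; apply: (hfieldZ hxi) => //.
  exact: (hfieldI oU hxi).
move=> q u Uq Hu; have tu := H_tangent hxi Uq Hu; have HFq := FH Uq.
have HnF : H q (nabla q (F q) F).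
  by apply: nablaFH => //; exact: (H_tangent hxi).
have HIF s : H q (I s q (F q)) by exact: (H_I hxi).
have Hs : H q (\sum_s (2 * xi s q f) *: I s q (F q)).
  by apply: (H_sum hxi) => // s; exact: (H_scale hxi).
rewrite (gZl hxi)//; last exact: (H_add hxi).
rewrite gDl// (g_suml hxi)//.
transitivity (u (fun r => g r (F r) (F r)) : R).
  apply/esym/(tangent_ext tu oU Uq); first exact: g_smooth.
  exact: hgrad_norm2E.
rewrite (nabla_metric Uq tu hF hF) [X in _ + X]gC//; last exact: nablaFH.
rewrite -mulr2n -[LHS]mulr_natl; congr (_ * _).
have /eqP := hessian_antisym Uq Hu HFq; rewrite subr_eq addrC => /eqP ->.
congr (_ + _); rewrite -sumrN; apply: eq_bigr => s _.
rewrite (g_I_skew hxi)// gC//; ring.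
Qed.

(** * The Ricci term *)

(** The matrix [om] of the connection in an orthonormal frame is skew, so the
    derivatives of the frame do not contribute to traces. *)
Lemma frame_rotation p v : U p -> tangent p v ->
  \sum_a (g p (nabla p (nabla p v (e a)) F) (e a p)
          + g p (nabla p (e a p) F) (nabla p v (e a))) = 0 :> R.
Proof.
move=> Up tv; pose om a b := g p (nabla p v (e a)) (e b p).
have He a : H p (e a p) by exact: frame_H.
have te a : tangent p (e a p) by exact: frame_tangent.
have Hne a : H p (nabla p v (e a)) by apply: nabla_H => //; exact: frame_hfield.
have HnF a : H p (nabla p (e a p) F) by exact: nablaFH.
have omC a b : om a b + om b a = 0.
  rewrite /om [X in _ + X]gC//.
  rewrite -(nabla_metric Up tv (frame_hfield a) (frame_hfield b)).
  rewrite -[RHS](tangent_cst tv oU Up (a == b)%:R).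
  apply/esym/(tangent_ext tv oU Up); first exact: smooth_on_cst.
  by move=> q Uq; case: he => _ /(_ a b q Uq).
have E1 a : g p (nabla p (nabla p v (e a)) F) (e a p)
    = \sum_b om a b * g p (nabla p (e b p) F) (e a p).
  rewrite {1}(frame_expansion Up (Hne a)).
  by rewrite (nabla_dir_sum cn oU)//; [rewrite (g_suml hxi)|exact: hF.1].
have E2 a : g p (nabla p (e a p) F) (nabla p v (e a))
    = \sum_b om a b * g p (nabla p (e a p) F) (e b p).
  by rewrite parseval//; apply: eq_bigr => b _; rewrite mulrC.
rewrite big_split/= (eq_bigr _ (fun a _ => E1 a)) (eq_bigr _ (fun a _ => E2 a)).
rewrite [X in X + _]exchange_big -big_split big1//= => a _.
rewrite -big_split big1//= => b _.
by rewrite -mulrDl omC mul0r.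
Qed.

Lemma g_extE p u v : U p -> H p u -> H p v -> g_ext S eta xi p u v = g p u v.
Proof.
move=> Up Hu Hv; rewrite /g_ext /proj_V.
have z w : H p w -> \sum_s eta s p w *: xi s p = 0.
  by move=> Hw; rewrite big1// => s _; rewrite (eta_H hxi)// scale0r.
by rewrite !z// !subr0 big1 ?addr0// => s _; rewrite (eta_H hxi)// mul0r.
Qed.

Lemma hgrad_dsublaplacian p : U p ->
  F p (sublaplacian nabla e f)
  = - \sum_a (g p (nabla p (F p) (fun q => nabla q (e a q) F)) (e a p)
              + g p (nabla p (e a p) F) (nabla p (F p) (e a))) :> R.
Proof.
move=> Up; have tF := hfield_tangent hF Up.
have hnF a : hfield H U (fun q => nabla q (e a q) F).
  exact: nabla_hfield (frame_hfield a).1 hF.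
have sg a : smooth_on U (fun q => g q (nabla q (e a q) F) (e a q)).
  exact: g_smooth (hnF a) (frame_hfield a).
have ss : smooth_on U (fun q => \sum_a g q (nabla q (e a q) F) (e a q)).
  exact: smooth_on_sum.
transitivity (F p (fun q => - \sum_a g q (nabla q (e a q) F) (e a q)) : R).
  apply/esym/(tangent_ext tF oU Up); first exact: smooth_onN.
  by move=> q Uq; rewrite (sublaplacian_div gradF).
rewrite (tangentN tF oU Up)// (tangent_sum tF oU Up)//; congr (- _).
apply: eq_bigr => a _.
by rewrite (nabla_metric Up tF (hnF a) (frame_hfield a)).
Qed.

Lemma hess_norm2E p : U p -> hess_norm2 nabla e f p
  = \sum_a g p (nabla p (e a p) F) (nabla p (e a p) F).
Proof.
move=> Up; apply: eq_bigr => a _; have te := frame_tangent a Up.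
rewrite parseval//; try exact: nablaFH.
apply: eq_bigr => b _.
by rewrite -(hessian_hgrad gradF)//; exact: frame_hfield.
Qed.

(** The bracket is expressed by the torsion, whose value on horizontal fields
    is known. *)
Lemma nabla_bracket_frame p a : U p ->
  nabla p (bracket (e a) F p) F
  = nabla p (nabla p (e a p) F) F - nabla p (nabla p (F p) (e a)) F
    - \sum_s (2 * g p (I s p (e a p)) (F p)) *: nabla p (xi s p) F.
Proof.
move=> Up; have te := frame_tangent a Up; have tF := hfield_tangent hF Up.
have txi s : tangent p (xi s p) by exact: (reeb_tangent hxi).
have t1 : tangent p (nabla p (e a p) F).
  by apply: (nabla_tangent cn oU) => //; exact: hF.1.
have t2 : tangent p (nabla p (F p) (e a)).
  by apply: (nabla_tangent cn oU) => //; exact: (frame_hfield a).1.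
have tT : tangent p (\sum_s (2 * g p (I s p (e a p)) (F p)) *: xi s p).
  by apply: tangent_sumv => s; exact: tangentZ.
have -> : bracket (e a) F p = nabla p (e a p) F - nabla p (F p) (e a)
    - \sum_s (2 * g p (I s p (e a p)) (F p)) *: xi s p.
  rewrite -(torsion_horizontal Up (frame_hfield a) hF) /torsion.
  by rewrite opprB addrC subrK.
have hF1 := hF.1.
rewrite (nabla_dirB cn oU)//; last exact: tangentBv.
by rewrite (nabla_dirB cn oU)// (nabla_dir_sum cn oU).
Qed.

(** Expanding the curvature, the second derivatives [nabla_F (nabla_(e_a) F)]
    cancel against the derivative of the sub-Laplacian.  Of the derivative along
    the bracket [[e_a, F]], the part [nabla_F e_a] is absorbed by the rotation
    of the frame, the part [nabla_(e_a) F] gives the squared Hessian with its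
    arguments in the other order, hence the terms in [xi_s f], and the torsion
    gives the derivatives of [F] along [xi_s]. *)
Lemma weitzenboeck p : U p ->
  hess_norm2 nabla e f p - F p (sublaplacian nabla e f)
    + qc_Ric S nabla eta xi e F F p
  = \sum_a g p (nabla p (e a p) (fun q => nabla q (F q) F)) (e a p)
    + 2 * (\sum_s xi s p f * \sum_a g p (I s p (nabla p (e a p) F)) (e a p))
    - 2 * (\sum_s g p (nabla p (xi s p) F) (I s p (F p))) :> R.
Proof.
move=> Up; have HFp := FH Up; have tF := hfield_tangent hF Up.
have He a : H p (e a p) by exact: frame_H.
have te a : tangent p (e a p) by exact: frame_tangent.
have txi s : tangent p (xi s p) by exact: (reeb_tangent hxi).
have Hnxi s : H p (nabla p (xi s p) F) by exact: nablaFH.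
have HnF a : H p (nabla p (e a p) F) by exact: nablaFH.
have HIF s : H p (I s p (F p)) by exact: (H_I hxi).
have hnFF : hfield H U (fun q => nabla q (F q) F).
  exact: nabla_hfield hF.1 hF.
have hneF a : hfield H U (fun q => nabla q (e a q) F).
  exact: nabla_hfield (frame_hfield a).1 hF.
have HneF a : H p (nabla p (F p) (e a)).
  by apply: nabla_H => //; exact: frame_hfield.
pose A a := g p (nabla p (e a p) (fun q => nabla q (F q) F)) (e a p).
pose B a := g p (nabla p (nabla p (F p) (e a)) F) (e a p)
            + g p (nabla p (e a p) F) (nabla p (F p) (e a)).
pose C a := \sum_s xi s p f * g p (I s p (nabla p (e a p) F)) (e a p).
pose D a := \sum_s g p (nabla p (xi s p) F) (e a p) * g p (I s p (F p)) (e a p).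
have RicE a : curvature4 S nabla eta xi (e a) F F (e a) p
  = A a - g p (nabla p (F p) (fun q => nabla q (e a q) F)) (e a p)
    - g p (nabla p (nabla p (e a p) F) F) (e a p)
    + g p (nabla p (nabla p (F p) (e a)) F) (e a p)
    - 2 * D a.
  have H1 : H p (nabla p (e a p) (fun q => nabla q (F q) F)) by exact: nabla_H.
  have H2 : H p (nabla p (F p) (fun q => nabla q (e a q) F)) by exact: nabla_H.
  have H3 : H p (nabla p (nabla p (e a p) F) F).
    by apply: nablaFH => //; exact: (H_tangent hxi).
  have H4 : H p (nabla p (nabla p (F p) (e a)) F).
    by apply: nablaFH => //; exact: (H_tangent hxi).
  have H5 : H p (\sum_s (2 * g p (I s p (e a p)) (F p)) *: nabla p (xi s p) F).
    by apply: (H_sum hxi) => // s; exact: (H_scale hxi).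
  have H6 := H_sub hxi Up H3 H4.
  rewrite /curvature4 /curvature nabla_bracket_frame// g_extE//; last first.
    by apply: (H_sub hxi) => //; apply: (H_sub hxi).
  rewrite !gBl//; try by apply: (H_sub hxi).
  rewrite (g_suml hxi)//.
  have -> : \sum_s 2 * g p (I s p (e a p)) (F p)
      * g p (nabla p (xi s p) F) (e a p) = - (2 * D a).
    rewrite /D mulr_sumr -sumrN; apply: eq_bigr => s _.
    rewrite (g_I_skew hxi)// [g p (e a p) _]gC//; ring.
  rewrite /A; ring.
have term a : g p (nabla p (e a p) F) (nabla p (e a p) F)
    + (g p (nabla p (F p) (fun q => nabla q (e a q) F)) (e a p)
       + g p (nabla p (e a p) F) (nabla p (F p) (e a)))
    + curvature4 S nabla eta xi (e a) F F (e a) p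
  = A a + B a + 2 * C a - 2 * D a.
  have := hessian_antisym Up (He a) (HnF a).
  have -> : \sum_s 2 * g p (I s p (e a p)) (nabla p (e a p) F) * xi s p f
      = - (2 * C a).
    rewrite /C mulr_sumr -sumrN; apply: eq_bigr => s _.
    rewrite (g_I_skew hxi)// [g p (e a p) _]gC//; last exact: (H_I hxi).
    ring.
  rewrite RicE /B; lra.
rewrite hess_norm2E// hgrad_dsublaplacian// opprK /qc_Ric -!big_split/=.
rewrite (eq_bigr _ (fun a _ => term a)) sumrB big_split big_split/=.
have -> : \sum_a B a = 0 by exact: frame_rotation.
rewrite addr0 -!mulr_sumr; congr (_ + 2 * _ - 2 * _).
  by rewrite exchange_big; apply: eq_bigr => s _; rewrite mulr_sumr.
by rewrite exchange_big; apply: eq_bigr => s _; rewrite -parseval.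
Qed.

(** * Derivatives of the almost complex structures *)

Lemma reeb_vertical s : hfield (vertical xi) U (xi s).
Proof.
split; first exact: (reeb_vfield hxi.2 s).
move=> q Uq; exists (fun t => (t == s)%:R).
rewrite (bigD1 s)//= eqxx scale1r big1 ?addr0// => t /negPf ->.
by rewrite scale0r.
Qed.

Lemma phi_reeb s q u : U q -> phi eta I q (xi s q) u = I s q u.
Proof.
move=> Uq; rewrite /phi (bigD1 s)//= (reeb_dual hxi.2)// eqxx scale1r.
by rewrite big1 ?addr0// => t /negPf ts; rewrite (reeb_dual hxi.2)// ts scale0r.
Qed.

(** This is the parallelism of the identification of [xi_s] with [I_s],
    evaluated on the fields [xi s]. *)
Lemma nabla_I p v X s : U p -> tangent p v -> hfield H U X ->
  nabla p v (fun q => I s q (X q))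
  = I s p (nabla p v X)
    + \sum_t eta t p (nabla p v (xi s)) *: I t p (X p).
Proof.
move=> Up tv hX; have hIX := hfieldI oU hxi s hX.
have := biq_phi bq oU hxi Up tv (reeb_vertical s) hX.
rewrite phi_reeb// => /eqP; rewrite subr_eq addrC => /eqP <-.
apply: (nabla_ext cn oU) => //; first exact: hIX.1.
by move=> q Uq; rewrite phi_reeb.
Qed.

Lemma nabla_reeb p v s : U p -> tangent p v ->
  nabla p v (xi s) = \sum_t eta t p (nabla p v (xi s)) *: xi t p.
Proof.
move=> Up tv; have [c cE] := biq_V bq oU hxi Up tv (reeb_vertical s).
rewrite cE; apply: eq_bigr => t _; congr (_ *: _).
rewrite (eta_sum hxi)//; last by move=> k; exact: (reeb_tangent hxi).
rewrite (bigD1 t)//= (reeb_dual hxi.2)// eqxx mulr1 big1 ?addr0// => k kt.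
by rewrite (reeb_dual hxi.2)// eq_sym (negPf kt) mulr0.
Qed.

(** The connection on the vertical bundle is metric, because the connection
    on the span of the [I s] preserves the inner products of [I s X] and
    [I t X] for a horizontal unit vector field [X]. *)
Lemma reeb_connection_antisym p v s t : (0 < n)%N -> U p -> tangent p v ->
  eta t p (nabla p v (xi s)) = - eta s p (nabla p v (xi t)).
Proof.
move=> n_gt0 Up tv.
have n4 : (0 < 4 * n)%N by rewrite muln_gt0.
pose X := e (Ordinal n4); pose N := nabla p v X.
have hX : hfield H U X by exact: frame_hfield.
have XX q : U q -> g q (X q) (X q) = 1.
  by case: he => _ orth _ Uq; rewrite orth// eqxx.
have HX : H p (X p) by exact: hX.2.
have HN : H p N by exact: nabla_H.
have HIX k : H p (I k p (X p)) by exact: (H_I hxi).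
have HIN k : H p (I k p N) by exact: (H_I hxi).
have d0 Y Z (c : R) : hfield H U Y -> hfield H U Z ->
    (forall q, U q -> g q (Y q) (Z q) = c) ->
    g p (nabla p v Y) (Z p) + g p (Y p) (nabla p v Z) = 0.
  move=> hY hZ YZ; rewrite -(nabla_metric Up tv hY hZ).
  rewrite -[RHS](tangent_cst tv oU Up c).
  by apply/esym/(tangent_ext tv oU Up) => [|q Uq];
    [exact: smooth_on_cst|rewrite YZ].
have NX : g p N (X p) = 0.
  by have := d0 _ _ _ hX hX XX; rewrite [X in _ + X]gC//; lra.
(* [N] is orthogonal to [X], and for k != l the operators [I k] and [I l]
   anticommute: this is the polarised form of [g_I_orth]. *)
have IIN k l : g p (I k p N) (I l p (X p)) + g p (I k p (X p)) (I l p N) = 0.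
  have [->|kl] := eqVneq k l.
    rewrite [X in _ + X]gC// (qcl_isometry qcl)//; lra.
  rewrite [X in _ + X]gC// !(g_I_skew hxi)// (I_anticomm hxi Up kl)//.
  by rewrite (gNr hxi)//; [lra|exact: (H_I hxi)].
have gom k l : g p (\sum_r eta r p (nabla p v (xi k)) *: I r p (X p))
    (I l p (X p)) = eta l p (nabla p v (xi k)).
  rewrite (g_suml hxi)// (bigD1 l)//= big1 ?addr0.
    by rewrite (g_I_orth hxi)// eqxx XX// !mulr1.
  by move=> r /negPf rl; rewrite (g_I_orth hxi)// rl mul0r mulr0.
have Hom k : H p (\sum_r eta r p (nabla p v (xi k)) *: I r p (X p)).
  by apply: (H_sum hxi) => // r; exact: (H_scale hxi).
have := d0 _ _ _ (hfieldI oU hxi s hX) (hfieldI oU hxi t hX)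
  (fun q Uq => etrans (g_I_orth hxi Uq s t (hX.2 q Uq))
                      (congr1 _ (XX q Uq))).
rewrite !nabla_I// gDl// gom [X in _ + X]gC//; last exact: (H_add hxi).
rewrite gDl// gom [g p (I t p N) _]gC//; have := IIN s t; lra.
Qed.

Lemma frame_derivation p u h : U p -> H p u ->
  \sum_a e a p h * g p u (e a p) = u h :> R.
Proof.
move=> Up Hu; rewrite [in RHS](frame_expansion Up Hu) comb_apply.
by apply: eq_bigr => a _; rewrite mulrC.
Qed.

(** * Divergences and vertical terms *)

Lemma div_scale p h X : U p -> smooth_on U h -> hfield H U X ->
  \sum_a g p (nabla p (e a p) (fun q => h q *: X q)) (e a p)
  = X p h + h p * \sum_a g p (nabla p (e a p) X) (e a p) :> R.
Proof.
move=> Up sh hX; have HX : H p (X p) by exact: hX.2.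
rewrite -(frame_derivation h Up HX) mulr_sumr -big_split/=.
apply: eq_bigr => a _; have te := frame_tangent a Up; have He := frame_H a Up.
have Hn : H p (nabla p (e a p) X) by exact: nabla_H.
rewrite (nabla_leibniz cn oU)//; last exact: hX.1.
by rewrite gDl ?(gZl hxi)//; exact: (H_scale hxi).
Qed.

(** The trace of the derivative of [I_s] is
    [sum_t eta_t (nabla_(I_t F) xi_s)].  Multiplied by [xi_s f] and summed over
    [s], the skew symmetry in [s] and [t] turns it into the derivatives of [f]
    along the vertical vectors [nabla_(I_t F) xi_t]. *)
Lemma div_I p : (0 < n)%N -> U p ->
  \sum_s xi s p f
      * \sum_a g p (nabla p (e a p) (fun q => I s q (F q))) (e a p)
  = \sum_s xi s p f * \sum_a g p (I s p (nabla p (e a p) F)) (e a p)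
    - \sum_s nabla p (I s p (F p)) (xi s) f :> R.
Proof.
move=> n_gt0 Up; have HF := FH Up.
have HIF s : H p (I s p (F p)) by exact: (H_I hxi).
have tIF s : tangent p (I s p (F p)) by exact: (H_tangent hxi).
have te a := frame_tangent a Up; have He a := frame_H a Up.
pose om s t := eta t p (nabla p (I t p (F p)) (xi s)).
have vxi s : vfield U (xi s) by exact: (reeb_vfield hxi.2 s).
have omE s t : om s t
    = \sum_a eta t p (nabla p (e a p) (xi s)) * g p (I t p (F p)) (e a p).
  rewrite /om {1}(frame_expansion Up (HIF t)) (nabla_dir_sum cn oU)//.
  rewrite (eta_sum hxi)//; last first.
    by move=> a; exact: (nabla_tangent cn oU).
  by apply: eq_bigr => a _; rewrite mulrC.
have traceE s :
    \sum_a g p (nabla p (e a p) (fun q => I s q (F q))) (e a p)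
    = \sum_a g p (I s p (nabla p (e a p) F)) (e a p) + \sum_t om s t.
  rewrite (eq_bigr _ (fun t _ => omE s t)).
  rewrite [X in _ + X]exchange_big -big_split/=.
  apply: eq_bigr => a _; rewrite nabla_I// gDl//.
  - by rewrite (g_suml hxi).
  - by apply: (H_I hxi) => //; exact: nablaFH.
  - by apply: (H_sum hxi) => // t; exact: (H_scale hxi).
under eq_bigr do rewrite traceE mulrDr.
rewrite big_split/=; congr (_ + _); rewrite -sumrN.
under eq_bigr do rewrite mulr_sumr.
rewrite exchange_big; apply: eq_bigr => t _ /=.
rewrite nabla_reeb// comb_apply -sumrN; apply: eq_bigr => s _.
by rewrite /om (reeb_connection_antisym s t n_gt0 Up (tIF t)); ring.
Qed.

(** This torsion is horizontal, so its product with [F] is its action on [f],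
    which measures the asymmetry of the Hessian at [xi_s] and [I_s F]. *)
Lemma torsion_reeb p s : U p ->
  torsion3 S nabla eta xi (xi s) (fun q => I s q (F q)) F p
  = I s p (F p) (fun q => xi s q f) - nabla p (I s p (F p)) (xi s) f
    - g p (nabla p (xi s p) F) (I s p (F p)) :> R.
Proof.
move=> Up; have hIF := hfieldI oU hxi s hF.
have txi : tangent p (xi s p) by exact: (reeb_tangent hxi).
have HF := FH Up.
have HT := biq_torsion_V_endo bq oU hxi Up (reeb_vertical s) hIF.
rewrite /torsion3 g_extE// gC// g_hgrad//.
rewrite -(hessian_hgrad gradF Up txi hIF).
rewrite -[LHS]/(nabla p (xi s p) (fun q => I s q (F q)) f
  - nabla p (I s p (F p)) (xi s) f - bracket (xi s) (fun q => I s q (F q)) p f).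
rewrite (bracketE oU)//; ring.
Qed.

Lemma hessian_reeb p s : U p ->
  hessian nabla f (xi s) (fun q => I s q (F q)) p
  = g p (nabla p (xi s p) F) (I s p (F p)).
Proof.
move=> Up; have hIF := hfieldI oU hxi s hF.
by rewrite -(hessian_hgrad gradF Up _ hIF)//; exact: (reeb_tangent hxi).
Qed.

(** The divergence of the gradient found in [hgrad_norm2_hgrad]. *)
Lemma half_sublaplacian_norm2 p : U p ->
  - (1 / 2) * sublaplacian nabla e (hgrad_norm2 e f) p
  = \sum_a g p (nabla p (e a p) (fun q => nabla q (F q) F)) (e a p)
    + 2 * (\sum_s I s p (F p) (fun q => xi s q f))
    + 2 * (\sum_s xi s p f
             * \sum_a g p (nabla p (e a p) (fun q => I s q (F q))) (e a p))
    :> R.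
Proof.
move=> Up.
pose K s q := 2 * xi s q f; pose Y s q := K s q *: I s q (F q).
have hIF s : hfield H U (fun q => I s q (F q)) by exact: (hfieldI oU hxi).
have sxi s : smooth_on U (fun q => xi s q f).
  exact: (vfield_smooth oU (reeb_vfield hxi.2 s)).
have sK s : smooth_on U (K s).
  by apply: smooth_onM => //; exact: smooth_on_cst.
have hY s : hfield H U (Y s) by exact: (hfieldZ hxi).
have hYs : hfield H U (fun q => \sum_s Y s q) by exact: (hfield_sum hxi).
have hnFF : hfield H U (fun q => nabla q (F q) F).
  exact: nabla_hfield hF.1 hF.
rewrite (sublaplacian_div hgrad_norm2_hgrad)//.
have divE a : g p (nabla p (e a p) (fun q => 2 *: (nabla q (F q) F
                  + \sum_s (2 * xi s q f) *: I s q (F q)))) (e a p)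
    = 2 * (g p (nabla p (e a p) (fun q => nabla q (F q) F)) (e a p)
           + \sum_s g p (nabla p (e a p) (Y s)) (e a p)).
  have te := frame_tangent a Up; have He := frame_H a Up.
  have HnY s : H p (nabla p (e a p) (Y s)) by exact: nabla_H.
  have Hn : H p (nabla p (e a p) (fun q => nabla q (F q) F)) by exact: nabla_H.
  have Hs : H p (\sum_s nabla p (e a p) (Y s)) by exact: (H_sum hxi).
  rewrite (nabla_fieldZ cn oU)//; last exact: (hfieldD hxi hnFF hYs).1.
  rewrite (nabla_fieldD cn oU (Y := fun q => \sum_s Y s q))//;
    [|exact: hnFF.1|exact: hYs.1].
  rewrite (nabla_field_sum cn oU)//; last by move=> s; exact: (hY s).1.
  rewrite (gZl hxi)//; last exact: (H_add hxi).
  rewrite gDl//; congr (_ * (_ + _)).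
  under eq_bigr do rewrite -[nabla _ _ _]scale1r.
  by rewrite (g_suml hxi)//; under eq_bigr do rewrite mul1r.
rewrite (eq_bigr _ (fun a _ => divE a)) -mulr_sumr big_split/= exchange_big/=.
have divY s : \sum_a g p (nabla p (e a p) (Y s)) (e a p)
    = 2 * I s p (F p) (fun q => xi s q f)
      + 2 * (xi s p f
         * \sum_a g p (nabla p (e a p) (fun q => I s q (F q))) (e a p)) :> R.
  rewrite (div_scale Up (sK s) (hIF s)) mulrA; congr (_ + _).
  have tIF := hfield_tangent (hIF s) Up.
  rewrite /K (tangentM tIF oU Up) ?(tangent_cst tIF oU Up) ?mul0r ?add0r//.
  exact: smooth_on_cst.
rewrite (eq_bigr _ (fun s _ => divY s)) big_split/= -!mulr_sumr.
by field.
Qed.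

End FixedFunction.
End Bochner.

(** * The Bochner formula *)

Theorem theorem3p1 (R : realType) (n : nat) (n_gt0 : (0 < n)%N)
  (M : manifold R (4 * n).+3) (S : qc_structure M)
  (nabla : M -> tvec M -> field M -> tvec M) (hnabla : biquard S nabla)
  (f : M -> R) (hf : smooth_on [set: M] f)
  (U : set M) (hU : open U)
  (eta : 'I_3 -> M -> tvec M -> R) (I : 'I_3 -> M -> tvec M -> tvec M)
  (xi : 'I_3 -> field M) (hxi : qc_reeb_frame S U eta I xi)
  (e : 'I_(4 * n) -> field M) (he : orthonormal_hframe S U e)
  (p : M) (hp : U p) :
  - (1 / 2) * sublaplacian nabla e (hgrad_norm2 e f) p
  = hess_norm2 nabla e f p
    - g_ext S eta xi p (hgrad S (sublaplacian nabla e f) p) (hgrad S f p)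
    + qc_Ric S nabla eta xi e (hgrad S f) (hgrad S f) p
    + 2 * (\sum_(s < 3) torsion3 S nabla eta xi
             (xi s) (fun q => I s q (hgrad S f q)) (hgrad S f) p)
    + 4 * (\sum_(s < 3) hessian nabla f
             (xi s) (fun q => I s q (hgrad S f q)) p).
Proof.
have sf : smooth_on U f by exact: smooth_onW hf.
have HF : qcH S p (hgrad S f p) by exact: (hgrad_H hxi he).
have HFL := hgrad_H hxi he (sublaplacian nabla e f) hp.
rewrite (half_sublaplacian_norm2 hnabla hU hxi he sf hp).
rewrite (div_I hnabla hU hxi he sf n_gt0 hp).
rewrite (g_extE hxi hp HFL HF) (g_hgrad hxi he _ hp HF).
rewrite (weitzenboeck hnabla hU hxi he sf hp).
rewrite (eq_bigr _ (fun s _ => torsion_reeb hnabla hU hxi he sf s hp)).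
rewrite (eq_bigr _ (fun s _ => hessian_reeb hnabla hU hxi he sf s hp)).
rewrite !sumrB; ring.
Qed.
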